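(* Let $\mathbb{F}=\mathbb{R}$ or $\mathbb{F}=\mathbb{C}$, let $m\geq n\geq 1$ be integers, and let $X,Y\in M_{m\times n}(\mathbb{F})$ with $X\neq 0$. There is a Hermitian $A\in M_{m}(\mathbb{F})$ such that $AX=Y$ if and only if $\operatorname{null} X\subseteq \operatorname{null} Y$ and $X^*Y$ is Hermitian.
   Context: $M_{m\times n}(\mathbb{F})$ is the set of $m\times n$ matrices over $\mathbb{F}$ and $M_m(\mathbb{F})=M_{m\times m}(\mathbb{F})$. $\operatorname{null} Z$ denotes the null space of $Z$, and $Z^*$ its conjugate transpose (the transpose if $\mathbb{F}=\mathbb{R}$). $A$ is Hermitian if $A=A^*$ (so Hermitian means real symmetric when $\mathbb{F}=\mathbb{R}$). *)

(* Defs.v *)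
From HB Require Import structures.
From mathcomp Require Import all_boot all_order all_algebra.
From mathcomp Require Import classical_sets reals.

Set Implicit Arguments.
Unset Strict Implicit.
Unset Printing Implicit Defensive.

Local Open Scope ring_scope.
Local Open Scope classical_set_scope.

Definition nullspace (F : fieldType) (m n : nat) (Z : 'M[F]_(m, n)) :
  set 'cV[F]_n := [set v | Z *m v = 0].

(* Main.v *)
(* If P is a generalized inverse of X, so that X P X = X, then null X <= null Y
   gives Y P X = Y. Hence A = Y P + (Y P)^* - P^* (X^* Y) P is Hermitian when
   X^* Y is, and A X = Y + P^* (Y^* X - X^* Y) = Y. This works over any field
   with an involution. *)

Require Import Defs.
From HB Require Import structures.
From mathcomp Require Import all_boot all_order all_algebra.
From mathcomp Require Import sesquilinear spectral.
From mathcomp Require Import classical_sets reals.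
From mathcomp Require Import complex.

Set Implicit Arguments.
Unset Strict Implicit.
Unset Printing Implicit Defensive.

Import Order.TTheory GRing.Theory Num.Theory.
Local Open Scope ring_scope.
Local Open Scope classical_set_scope.
Local Open Scope sesquilinear_scope.

(** The columns of [cokermx X] are killed by [X], hence by [Y], and [Y *m cokermx X = 0] is the
    criterion for the row space of [Y] to lie in that of [X]. Conversely, that inclusion is a
    factorization [Y = B *m X]. *)
Lemma nullspace_sub (F : fieldType) (m1 m2 n : nat)
    (X : 'M[F]_(m1, n)) (Y : 'M[F]_(m2, n)) :
  nullspace X `<=` nullspace Y <-> (Y <= X)%MS.
Proof.
split=> [sXY | /submxP[B ->] v /= Xv0]; last first.
  by rewrite /nullspace /= -mulmxA Xv0 mulmx0.
rewrite submxE; apply/eqP/matrixP=> i j.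
have Xcol0 : X *m col j (cokermx X) = 0 by rewrite colE mulmxA mulmx_coker mul0mx.
have := sXY _ Xcol0; rewrite /nullspace /= colE mulmxA -colE => /colP/(_ i).
by rewrite mxE => ->; rewrite !mxE.
Qed.

Section HermitianSolution.

Variables (F : fieldType) (theta : involutive_rmorphism F).
Local Notation "M ^H" := (M ^t theta) (at level 8, format "M ^H").

Lemma star_mul (m n p : nat) (A : 'M[F]_(m, n)) (B : 'M[F]_(n, p)) :
  (A *m B)^H = B^H *m A^H.
Proof. by rewrite trmx_mul map_mxM. Qed.

Lemma star_star (m n : nat) (A : 'M[F]_(m, n)) : A^H^H = A.
Proof. by apply/matrixP=> i j; rewrite !mxE rmorphK. Qed.

Lemma hermitianmx_starP (n : nat) (A : 'M[F]_n) :
  reflect (A^H = A) (A \is hermitianmx n false theta).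
Proof. by rewrite is_hermitianmxE expr0 scale1r eq_sym; apply: eqP. Qed.

Lemma hermitian_solvable (m n : nat) (X Y : 'M[F]_(m, n)) :
  (exists A : 'M[F]_m, A \is hermitianmx m false theta /\ A *m X = Y) <->
  (nullspace X `<=` nullspace Y /\ X^H *m Y \is hermitianmx n false theta).
Proof.
split=> [[A [/hermitianmx_starP Aherm <-]] | [/nullspace_sub sYX]].
  split; first by apply/nullspace_sub; exact: submxMl.
  (* Here [Y] is [A *m X], and the star of [X^H *m A *m X] is [X^H *m A^H *m X]. *)
  by apply/hermitianmx_starP; rewrite !star_mul star_star Aherm mulmxA.
move/hermitianmx_starP=> XYherm.
have [P YPX] : exists P : 'M[F]_(n, m), Y *m P *m X = Y.
  (* The row space inclusion [sYX] is what makes [pinvmx X *m X] fix [Y] from the right. *)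
  by exists (pinvmx X); exact: mulmxKpV.
have YX : Y^H *m X = X^H *m Y by rewrite -[RHS]XYherm star_mul star_star.
exists (Y *m P + (Y *m P)^H - P^H *m (X^H *m Y) *m P); split.
  apply/hermitianmx_starP.
  (* The star swaps the first two summands and, by [YX], fixes the third. *)
  rewrite linearB linearD /= map_mxB map_mxD /= star_star !star_mul.
  by rewrite !star_star YX !mulmxA (addrC _ (Y *m P)).
(* The last two terms both become [P^H *m (X^H *m Y)] and cancel. *)
rewrite mulmxBl mulmxDl YPX star_mul -!mulmxA YX [Y *m (P *m X)]mulmxA YPX.
by rewrite addrK.
Qed.

End HermitianSolution.

Theorem theorem4p1 (R : realType) (m n : nat) (hn : (1 <= n)%N)
    (hmn : (n <= m)%N) :
  (forall X Y : 'M[R]_(m, n), X != 0 ->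
     (exists A : 'M[R]_m, A \is symmetricmx /\ A *m X = Y) <->
     (nullspace X `<=` nullspace Y /\ X^T *m Y \is symmetricmx))
  /\
  (forall X Y : 'M[R[i]]_(m, n), X != 0 ->
     (exists A : 'M[R[i]]_m, A \is hermsymmx /\ A *m X = Y) <->
     (nullspace X `<=` nullspace Y /\ X ^t* *m Y \is hermsymmx)).
Proof.
(* The complex case takes conjugation as the involution; the real case takes the identity, for which
   the star is the plain transpose. *)
split=> X Y _; last exact: (hermitian_solvable Num.conj X Y).
by have := hermitian_solvable idfun X Y; rewrite map_mx_id.
Qed.
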